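(* Let $\mathcal{H}=\{rrr,rrb,yyr\}$. Then, as $n\to\infty$, $h_2(n,\mathcal{H})=\Omega(n^{2/3}\log^{1/3}n)$ and $h_2(n,\mathcal{H})=O(n^{3/4}\log n)$.
   Context: Edge-colorings of the complete graph $K_n$ use colors from $\{r,b,y\}$ (red, blue, yellow); they need not be proper, and not all colors need be used. A pattern is an edge-colored triangle, denoted by the multiset of the colors of its three edges; e.g. $rrr$ is the all-red triangle, $rrb$ is the triangle with two red edges and one blue edge, and $yyr$ has two yellow edges and one red edge. For a family $\mathcal{H}$ of patterns, $\operatorname{Forb}(n,\mathcal{H})$ is the set of all edge-colorings of $K_n$ with colors from $\{r,b,y\}$ in which no triangle has a coloring belonging to $\mathcal{H}$. For an edge-coloring $c$ of $K_n$, $h_2(c)$ is the maximum $k$ such that there is a set of $k$ vertices whose induced edges use at most two of the three colors. Finally, $h_2(n,\mathcal{H})=\min\{h_2(c): c\in\operatorname{Forb}(n,\mathcal{H})\}$. Here $\log$ is the base-2 logarithm. *)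

(* Defs.v *)
From HB Require Import structures.
From mathcomp Require Import all_boot all_order all_algebra.
From mathcomp Require Import finmap multiset.
From mathcomp Require Import all_classical all_reals all_analysis.

Set Implicit Arguments.
Unset Strict Implicit.
Unset Printing Implicit Defensive.

Import Order.TTheory GRing.Theory Num.Theory.
Import numFieldNormedType.Exports.

Inductive color := Red | Blue | Yellow.

Definition ord_of_color (x : color) : 'I_3 :=
  match x with
  | Red => @Ordinal 3 0 isT
  | Blue => @Ordinal 3 1 isT
  | Yellow => @Ordinal 3 2 isT
  end.

Definition color_of_ord (i : 'I_3) : color :=
  match val i with 0 => Red | 1 => Blue | _ => Yellow end.

Lemma ord_of_colorK : cancel ord_of_color color_of_ord.
Proof. by case. Qed.

HB.instance Definition _ := Finite.copy color (can_type ord_of_colorK).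

Section Colorings.

Variable n : nat.

Definition edge := {e : {set 'I_n} | #|e| == 2}.

Definition coloring := {ffun edge -> color}.

Definition edges_in (S : {set 'I_n}) : {set edge} :=
  [set e : edge | val e \subset S].

Definition pattern_of (c : coloring) (T : {set 'I_n}) : {mset color}%mset :=
  seq_mset [seq c e | e in edges_in T].

Definition Forb (H : {fset {mset color}%mset}%fset) : {set coloring} :=
  [set c : coloring |
    [forall T : {set 'I_n}, (#|T| == 3) ==> (pattern_of c T \notin H)]].

Definition h2_col (c : coloring) : nat :=
  \max_(S : {set 'I_n} | #|[set c e | e in edges_in S]| <= 2) #|S|.

(* The neutral element n does not affect the minimum when Forb H is nonempty,
   as h2_col c <= n for every c. *)
Definition h2 (H : {fset {mset color}%mset}%fset) : nat :=
  \big[minn/n]_(c in Forb H) h2_col c.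

End Colorings.

Definition log2 (R : realType) (x : R) : R := (ln x / ln 2)%R.

(* Main.v *)
(** Lower bound: in a coloring avoiding the three patterns the red graph has no
    closed walk of length 3 or 5, and its independent sets use two colors.
    Neighbourhoods and second neighbourhoods in such a graph are independent;
    harvesting the neighbourhoods of the vertices of large degree leaves a
    triangle-free graph of small maximum degree D, where the average over all
    independent sets (Shearer) yields one of size about n log D / D.
    Upper bound: given a graph without closed walks of length 3 and 5, color its
    edges red, the pairs with a common neighbour yellow, and the other pairs blue;
    the two-colored sets then have at most 2 alpha + 1 vertices. Such a graph with
    alpha = O(n^(3/4) log n) is obtained from a random graph of density about
    n^(-3/4) by deleting the edges of a maximal family of edge-disjoint cycles of
    length 3 and 5 (Erdos, Krivelevich). Random graphs appear as the weights
    x^|G|, of total mass (1 + x)^binom(n,2). *)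

Require Import Defs.
From mathcomp Require Import all_boot all_order all_algebra.
From mathcomp Require Import finmap multiset.
From mathcomp Require Import zify ring lra.
From mathcomp Require Import all_classical all_reals all_analysis.
(* The names of finset are otherwise shadowed by those of classical_sets. *)
From mathcomp.boot Require Import fintype finset.

Set Implicit Arguments.
Unset Strict Implicit.
Unset Printing Implicit Defensive.

Import Order.TTheory GRing.Theory Num.Theory.
Import numFieldNormedType.Exports.

(** * Independent sets in graphs of odd girth at least 7 *)

Definition independent (T : finType) (e : rel T) (A : {set T}) : bool :=
  [forall u in A, forall v in A, ~~ e u v].

Definition nbhd (T : finType) (e : rel T) (U : {set T}) (v : T) : {set T} :=
  [set w in U | e v w].

Lemma independentP (T : finType) (e : rel T) (A : {set T}) :
  reflect {in A &, forall u v, ~~ e u v} (independent e A).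
Proof.
apply: (iffP forall_inP) => [h u v uA vA|h u uA].
  by have /forall_inP := h u uA; apply.
by apply/forall_inP => v vA; apply: h.
Qed.

Lemma independentS (T : finType) (e : rel T) (A B : {set T}) :
  A \subset B -> independent e B -> independent e A.
Proof.
move=> /subsetP sAB /independentP iB; apply/independentP => u v uA vA.
by apply: iB; apply: sAB.
Qed.

(** Complementation pairs [A] with [F :\: A], whose sizes add up to [#|F|]; both sides are doubled
    to avoid halving. *)
Lemma sum_card_subsets (T : finType) (F : {set T}) :
  (\sum_(A in powerset F) #|A|).*2 = #|F| * 2 ^ #|F|.
Proof.
have -> : (\sum_(A in powerset F) #|A|).*2 =
    \sum_(A in powerset F) #|A| + \sum_(A in powerset F) #|F :\: A|.
  rewrite -addnn; congr (_ + _).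
  rewrite (reindex_onto (fun A => F :\: A) (fun A => F :\: A)) /=; last first.
    by move=> A; rewrite powersetE => /setIidPr {2}<-; rewrite setDDr setDv set0U.
  apply: eq_bigl => A; rewrite !powersetE subsetDl /=.
  rewrite setDDr setDv set0U; apply/eqP/idP => [<-|/setIidPr //].
  exact: subsetIl.
rewrite -big_split /=.
rewrite (eq_bigr (fun=> #|F|)) => [|A]; last first.
  by rewrite powersetE => sAF; rewrite cardsD (setIidPr sAF) subnKC ?subset_leq_card.
by rewrite sum_nat_const card_powerset mulnC.
Qed.

(** * Averages over the independent sets of a triangle-free graph *)

Section LocalAverage.

Variables (T : finType) (e : rel T).
Hypotheses (e_sym : symmetric e) (e3 : forall u v w, e u v -> e v w -> ~~ e u w).

Let e_irr u : ~~ e u u.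
Proof. by apply/negP => euu; have := e3 euu euu; rewrite euu. Qed.

Definition indep_subsets (U : {set T}) : {set {set T}} :=
  [set W : {set T} | (W \subset U) && independent e W].

Section Fiber.

Variables (U H : {set T}) (v : T).
Hypotheses (vU : v \in U) (HU : H \subset U) (iH : independent e H).
Hypothesis Hdisj : [disjoint H & v |: nbhd e U v].

Let F := [set w in nbhd e U v | [forall x in H, ~~ e w x]].

(* Given its trace H outside the closed neighbourhood of v, an independent set
   meets that neighbourhood in {v} or in an arbitrary subset of F. *)
Lemma fiber_outside_nbhd :
  [set W in indep_subsets U | W :\: (v |: nbhd e U v) == H] =
  (v |: H) |: ((fun A => H :|: A) @: powerset F).
Proof.
have Hv w : w \in H -> w != v /\ ~~ e v w.
  move=> wH; have := disjointFr Hdisj wH; rewrite !inE (subsetP HU _ wH) /=.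
  by move/negbT; rewrite negb_or => /andP.
have HF : H :\: (v |: nbhd e U v) = H by apply/setDidPl.
apply/setP => W; rewrite in_setU1 in_set [W \in indep_subsets U]in_set; apply/idP/idP.
- move=> /andP[/andP[WU /independentP iW] /eqP defH].
  case vW : (v \in W).
    apply/orP; left; apply/eqP/setP => w.
    rewrite -defH !inE; case: eqP => [-> //|_] /=.
    case wW: (w \in W); rewrite ?andbF ?andbT //= (negbTE (iW v w vW wW)).
    by rewrite andbF.
  apply/orP; right; apply/imsetP; exists (W :&: nbhd e U v).
    rewrite powersetE; apply/subsetP => w; rewrite !inE => /and3P[wW -> ->] /=.
    apply/forall_inP => x; rewrite -defH inE => /andP[_ xW].
    exact: iW.
  apply/setP => w; rewrite -defH !inE; case: eqP => [-> |_] /=.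
    by rewrite vW.
  by case: (w \in W); case: (w \in U); case: (e v w).
- case/orP => [/eqP ->|/imsetP[A]].
    apply/andP; split; last first.
      by rewrite setDUl HF; apply/eqP/setUidPr/subsetP=> w; rewrite !inE; case: (w == v); rewrite ?andbF.
    rewrite subUset sub1set vU HU; apply/independentP => x y.
    rewrite !inE => /orP[/eqP->|xH] /orP[/eqP->|yH] //.
    + by case: (Hv _ yH).
    + by rewrite e_sym; case: (Hv _ xH).
    + by move/independentP: iH; apply.
  rewrite powersetE => /subsetP AF ->.
  have AN w : w \in A -> [/\ w \in U, e v w & {in H, forall x, ~~ e w x}].
    by move/AF; rewrite !inE => /andP[/andP[-> ->] /forall_inP].
  apply/andP; split; last first.
    rewrite setDUl HF; apply/eqP/setUidPl/subsetP => w; rewrite !inE => /andP[+ wA].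
    by have [-> -> _] := AN _ wA; rewrite orbT.
  apply/andP; split.
    by rewrite subUset HU; apply/subsetP => w /AN[].
  apply/independentP => x y; rewrite !inE => /orP[xH|xA] /orP[yH|yA].
  + by move/independentP: iH; apply.
  + by rewrite e_sym; have [_ _] := AN _ yA; apply.
  + by have [_ _] := AN _ xA; apply.
  + have [_ vx _] := AN _ xA; have [_ vy _] := AN _ yA.
    by apply/negP => xy; have := e3 vx xy; rewrite vy.
Qed.

(** The fiber has [2 ^ #|F| + 1] members: [v |: H] contributes at least [4 * D], and the sets
    [H :|: A] contribute [2 * (#|F| * 2 ^ #|F|)] in all, as subsets of [F] have average size
    [#|F| / 2]. The second amount suffices when [L <= #|F|]; the first one when [#|F| < L], because
    [L * 2 ^ L <= D]. *)
Lemma fiber_average (D L : nat) : L * 2 ^ L <= D ->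
  L * #|[set W in indep_subsets U | W :\: (v |: nbhd e U v) == H]| <=
  \sum_(W in indep_subsets U | W :\: (v |: nbhd e U v) == H)
     4 * (D * (v \in W) + #|nbhd e U v :&: W|).
Proof.
move=> LD.
have -> g : \sum_(W in indep_subsets U | W :\: (v |: nbhd e U v) == H) g W =
   \sum_(W in [set W in indep_subsets U | W :\: (v |: nbhd e U v) == H]) g W.
  by apply: eq_bigl => W; rewrite [RHS]inE.
rewrite fiber_outside_nbhd.
have vH : v \notin H.
  by apply/negP => /(disjointFr Hdisj); rewrite !inE eqxx.
have vF : v \notin F by rewrite !inE (negbTE (e_irr v)) andbF.
have vnot A : A \in powerset F -> v \notin H :|: A.
  rewrite powersetE => /subsetP AF; rewrite inE negb_or vH.
  by apply: contra vF => /AF.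
have HN : [disjoint H & nbhd e U v].
  by apply: disjointWr Hdisj; apply: subsetUr.
have injU : {in powerset F &, injective (fun A => H :|: A)}.
  have FD A : A \in powerset F -> (H :|: A) :\: H = A.
    rewrite powersetE => AF; rewrite setDUl setDv set0U; apply/setDidPl.
    rewrite disjoint_sym; apply: disjointWr HN; apply: subset_trans AF _.
    by apply/subsetP => w; rewrite inE => /andP[].
  by move=> A B AF BF /(congr1 (fun X => X :\: H)); rewrite !FD.
have vnotim : v |: H \notin [set H :|: A | A in powerset F].
  by apply/imsetP => -[A AF] defA; have := vnot _ AF; rewrite -defA !inE eqxx.
rewrite (big_setU1 _ vnotim) /= cardsU1 vnotim (card_in_imset injU) card_powerset.
rewrite (big_imset _ injU) /=.
have -> : \sum_(A in powerset F)
    4 * (D * (v \in H :|: A) + #|nbhd e U v :&: (H :|: A)|) =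
    2 * (#|F| * 2 ^ #|F|).
  rewrite -sum_card_subsets -mul2n mulnA -big_distrr /=.
  congr (4 * _); apply: eq_bigr => A AF; rewrite (negbTE (vnot _ AF)) muln0 add0n.
  rewrite setIUr; have /eqP -> : nbhd e U v :&: H == set0.
    by rewrite setI_eq0 disjoint_sym.
  rewrite set0U; congr #|pred_of_set _|; apply/setIidPr.
  move: AF; rewrite powersetE => /subset_trans; apply.
  by apply/subsetP => w; rewrite inE => /andP[].
rewrite setU11 muln1.
have [LF|FL] := leqP L #|F|.
  apply: leq_trans (leq_addl _ _).
  have : 0 < 2 ^ #|F| by rewrite expn_gt0.
  by nia.
apply: leq_trans (leq_addr _ _).
have : 2 ^ #|F| <= 2 ^ L by rewrite leq_exp2l // ltnW.
have : 0 < 2 ^ L by rewrite expn_gt0.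
by nia.
Qed.

End Fiber.

(** Independent sets are grouped by their trace [f W] outside the closed neighbourhood of [v]; the
    inequality already holds in each group. *)
Lemma indep_subsets_average (U : {set T}) (v : T) (D L : nat) :
  v \in U -> L * 2 ^ L <= D ->
  L * #|indep_subsets U| <=
  \sum_(W in indep_subsets U) 4 * (D * (v \in W) + #|nbhd e U v :&: W|).
Proof.
move=> vU LD; pose f (W : {set T}) := W :\: (v |: nbhd e U v).
have fP W : W \in indep_subsets U -> f W \in f @: indep_subsets U.
  exact: imset_f.
rewrite -sum1_card big_distrr /= (partition_big _ _ fP) [leqRHS](partition_big _ _ fP) /=.
apply: leq_sum => H /imsetP[W0]; rewrite inE => /andP[W0U iW0] defH.
have HW0 : H \subset W0 by rewrite defH subsetDl.
apply: leq_trans (@fiber_average U H v vU (subset_trans HW0 W0U) _ _ D L LD).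
- rewrite -sum1_card big_distrr /= (eq_bigl (fun W => W \in
    [set W in indep_subsets U | W :\: (v |: nbhd e U v) == H])) //.
  by move=> W; rewrite [RHS]inE.
- exact: independentS HW0 iW0.
- by rewrite defH disjoint_sym disjoints_subset setCD subsetUr.
Qed.

(** Sum the local averages over [v] in [U] and exchange the sums: an independent [W] then receives
    four times [D * #|W|] plus the degrees of its vertices, hence at most [8 * D * h]. *)
Lemma triangle_free_independent (U : {set T}) (D L h : nat) :
  {in U, forall v, #|nbhd e U v| <= D} -> L * 2 ^ L <= D ->
  (forall A : {set T}, independent e A -> #|A| <= h) ->
  L * #|U| <= 8 * D * h.
Proof.
move=> degD LD hA.
have I0 : 0 < #|indep_subsets U|.
  apply/card_gt0P; exists set0; rewrite inE sub0set.
  by apply/independentP => x y; rewrite inE.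
rewrite -(leq_pmul2r I0).
have -> : L * #|U| * #|indep_subsets U| =
    \sum_(v in U) L * #|indep_subsets U|.
  by rewrite sum_nat_const mulnAC mulnC.
apply: (@leq_trans (\sum_(v in U) \sum_(W in indep_subsets U)
    4 * (D * (v \in W) + #|nbhd e U v :&: W|))).
  by apply: leq_sum => v vU; apply: indep_subsets_average.
rewrite exchange_big /= mulnC -sum_nat_const; apply: leq_sum => W.
rewrite inE => /andP[WU iW].
rewrite -big_distrr /= big_split /= -big_distrr /=.
have -> : \sum_(v in U) (v \in W) = #|W|.
  rewrite -big_mkcondr /= -sum1_card; apply: eq_bigl => x.
  by apply/andP/idP => [[] //|xW]; split=> //; apply: (subsetP WU).
(* Double counting of the adjacent pairs with one vertex in [U] and the other in [W]. *)
have -> : \sum_(v in U) #|nbhd e U v :&: W| = \sum_(w in W) #|nbhd e U w|.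
  under eq_bigr do rewrite -sum1_card big_mkcond /=.
  rewrite exchange_big /= [RHS]big_mkcond /=; apply: eq_bigr => w _.
  rewrite -big_mkcondr /=.
  case wW : (w \in W); last by rewrite big1 // => v; rewrite !inE wW !andbF.
  rewrite -sum1_card; apply: eq_bigl => v.
  by rewrite !inE wW (subsetP WU _ wW) /= andbT e_sym.
have : \sum_(w in W) #|nbhd e U w| <= #|W| * D.
  rewrite -sum_nat_const; apply: leq_sum => w wW.
  by apply: degD; apply: (subsetP WU).
have := hA _ iW; nia.
Qed.

End LocalAverage.

(** * Large independent sets when there are no closed walks of length 3 and 5 *)

Section OddGirth.

Variables (T : finType) (e : rel T) (h : nat).
Hypotheses (e_sym : symmetric e) (e3 : forall u v w, e u v -> e v w -> ~~ e u w).
Hypothesis e5 : forall u v a b c, e u v -> e v a -> e a b -> e b c -> ~~ e u c.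
Hypothesis e_alpha : forall A : {set T}, independent e A -> #|A| <= h.

Lemma nbhd_independent (V : {set T}) (v : T) : independent e (nbhd e V v).
Proof.
apply/independentP => x y; rewrite !inE => /andP[_ vx] /andP[_ vy].
by rewrite e_sym in vx; apply: e3 vx vy.
Qed.

(** An edge between [x] and [y] would close the walk [x, w, v, z, y] to length 5. *)
Lemma second_nbhd_independent (V : {set T}) (v : T) :
  independent e [set x in V | [exists w in nbhd e V v, e w x]].
Proof.
apply/independentP => x y; rewrite !inE.
move=> /andP[_ /exists_inP[w]]; rewrite inE => /andP[_ vw] wx.
move=> /andP[_ /exists_inP[z]]; rewrite inE => /andP[_ vz] zy.
by rewrite e_sym in vw; rewrite e_sym in wx; apply: e5 wx vw vz zy.
Qed.

(* As long as some vertex has more than D neighbours, its neighbourhood is moved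
   to I and the second neighbourhood, of size at most h, is thrown away. *)
Lemma remove_large_degrees (V : {set T}) (D D' : nat) : h <= D' * D.+1 ->
  exists I U : {set T}, [/\ independent e I, I \subset V,
    {in U, forall v, #|nbhd e U v| <= D} & #|V| <= #|I| * D'.+1 + #|U|].
Proof.
move=> hD; have [m] := ubnP #|V|; elim: m V => // m IHm V; rewrite ltnS => Vm.
have [deg|] := boolP [forall v in V, #|nbhd e V v| <= D].
  exists set0, V; split; rewrite ?sub0set //.
  - by apply/independentP => x y; rewrite inE.
  - exact/forall_inP.
  - exact: leq_addl.
rewrite negb_forall_in => /exists_inP[v vV]; rewrite -ltnNge => degv.
set N1 := nbhd e V v in degv; pose N2 := [set x in V | [exists w in N1, e w x]].
have iN1 : independent e N1 := nbhd_independent V v.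
have iN2 : independent e N2 := second_nbhd_independent V v.
have N1V : N1 \subset V by apply/subsetP => x; rewrite inE => /andP[].
have N2V : N2 \subset V by apply/subsetP => x; rewrite inE => /andP[].
have cV : #|V| <= #|N1| + #|N2| + #|V :\: (N1 :|: N2)|.
  rewrite -(cardsID (N1 :|: N2) V) leq_add2r.
  apply: leq_trans (subset_leq_card (subsetIr _ _)) _.
  by rewrite cardsU leq_subr.
have ltV : #|V :\: (N1 :|: N2)| < m.
  have : #|V :&: (N1 :|: N2)| + #|V :\: (N1 :|: N2)| = #|V| by apply: cardsID.
  have : #|N1| <= #|V :&: (N1 :|: N2)|.
    by apply: subset_leq_card; rewrite subsetI N1V subsetUl.
  lia.
have [I [U [iI IV degU cIU]]] := IHm _ ltV.
exists (I :|: N1), U; split=> //.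
(* A neighbour in [V] of a vertex of [N1] lies in [N2], and [I] was built after [N2] was removed. *)
- have NI x y : x \in N1 -> y \in I -> ~~ e x y.
    move=> xN1 yI; apply/negP => xy; have := subsetP IV _ yI.
    rewrite inE => /andP[/negP + yV]; apply; rewrite inE; apply/orP; right.
    by rewrite inE yV; apply/exists_inP; exists x.
  apply/independentP => x y; rewrite !in_setU => /orP[xI|xN] /orP[yI|yN].
  + by move/independentP: iI; apply.
  + by rewrite e_sym; apply: NI.
  + exact: NI.
  + by move/independentP: iN1; apply.
- by rewrite subUset N1V andbT; apply: subset_trans IV (subsetDl _ _).
- have -> : #|I :|: N1| = #|I| + #|N1|.
    rewrite cardsU (_ : I :&: N1 = set0) ?cards0 ?subn0 //.
    apply/eqP; rewrite setI_eq0; apply: disjointWl IV _.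
    by rewrite disjoint_sym disjoints_subset setCD setUC -setUA subsetUl.
  (* [#|N2| <= h <= D' * D.+1 <= D' * #|N1|], so at most [#|N1| * D'.+1] vertices are removed in
     this round. *)
  have := e_alpha iN2; nia.
Qed.

(* With D + 1 ~ nL/16h and D' + 1 ~ n/2h the two previous bounds contradict
   each other when h^3 is well below n^2 L. *)
Lemma odd_girth_independent (L : nat) : 2 ^ (4 * L) <= #|T| ->
  #|T| ^ 2 * L <= 2 ^ 15 * h ^ 3.
Proof.
set n := #|T| => nL; rewrite leqNgt; apply/negP => hsmall.
have L0 : 0 < L by move: hsmall; case: (L) => //; rewrite muln0.
have h0 : 0 < h.
  have /card_gt0P[v _] : 0 < n by apply: leq_trans nL; rewrite expn_gt0.
  apply: leq_trans (e_alpha (A := [set v]) _); first by rewrite cards1.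
  apply/independentP => x y /set1P -> /set1P ->; apply/negP => vv.
  by have := e3 vv vv; rewrite vv.
set P := 2 ^ L.
have LP : L < P by apply: ltn_expl.
have Pn : P ^ 4 <= n by rewrite -expnM mulnC.
(* Otherwise cubing gives [n ^ 3 <= 2 ^ 15 * h ^ 3 * P ^ 3 < n ^ 2 * L * P ^ 3], hence
   [n < L * P ^ 3 <= P ^ 4 <= n]. *)
have nhP : 32 * h * P < n.
  rewrite ltnNge; apply/negP; rewrite -(@leq_exp2r _ _ 3) //.
  rewrite !expnMn (_ : 32 = 2 ^ 5) // -(expnM 2 5 3).
  have -> : n ^ 3 = n ^ 2 * n by rewrite -expnSr.
  move=> n3; have : n ^ 2 * n < n ^ 2 * L * P ^ 3.
    by apply: leq_ltn_trans n3 _; rewrite ltn_pmul2r // expn_gt0 expn_gt0.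
  rewrite -mulnA ltnNge leq_mul2l => /negP; apply; apply/orP; right.
  by apply: leq_trans Pn; rewrite expnS leq_mul2r ltnW ?orbT.
(* [a] is the [D'.+1] of the harvesting step. The predecessor in [D] makes [16 * h * D] strictly
   smaller than [n * L], which is what the final contradiction uses. *)
pose a := n %/ (2 * h); pose D := (n * L).-1 %/ (16 * h).
have ha : 2 * h * a <= n by rewrite [leqLHS]mulnC leq_trunc_div.
have ha' : n < 2 * h * a.+1 by rewrite [ltnRHS]mulnC ltn_ceil // muln_gt0.
have hD : 16 * h * D <= (n * L).-1 by rewrite [leqLHS]mulnC leq_trunc_div.
have hD' : (n * L).-1 < 16 * h * D.+1 by rewrite [ltnRHS]mulnC ltn_ceil // muln_gt0.
have LD : L * P <= D.
  rewrite leq_divRL ?muln_gt0 //.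
  have : 32 * h * P * L < n * L by rewrite ltn_pmul2r.
  move: (n * L) => nL'; clear; lia.
have hP : h <= h * P by rewrite leq_pmulr // (leq_ltn_trans _ LP).
have a0 : 0 < a by rewrite lt0n; apply/eqP => a0; move: ha' nhP hP; rewrite a0; clear; lia.
have a4 : n <= 4 * h * a.-1.
  have : 32 * (h * P) < n by rewrite mulnA.
  move: (h * P) hP ha' (prednK a0) => p; move: (a.-1) => a' hp + def_a.
  by rewrite -def_a; clear -hp; lia.
(* The choices of [a] and [D] give [n ^ 2 * L <= 64 * h ^ 2 * (a.-1 * D.+1)]; a product below [h]
   would contradict [hsmall], with a factor 512 to spare. *)
have haD : h <= a.-1 * D.+1.
  have : n * (n * L) <= (4 * h * a.-1) * (16 * h * D.+1).
    by apply: leq_mul => //; move: hD'; case: (n * L).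
  rewrite mulnA mulnn => /(leq_trans hsmall) {}hsmall; rewrite leqNgt; apply/negP => hlt.
  have : 64 * h ^ 2 * (a.-1 * D.+1) <= 64 * h ^ 2 * h by rewrite leq_mul2l ltnW ?orbT.
  have : 2 ^ 15 * h ^ 3 = 512 * (64 * h ^ 2 * h) 
    by rewrite (expnSr h 2) -(mulnA 64); move: (h ^ 2 * h); clear; lia.
  have : 0 < h ^ 2 * h by rewrite -expnSr expn_gt0 h0.
  move: hsmall; rewrite -(mulnn h).
  move: (2 ^ 15 * h ^ 3) (n * n * L) (a.-1) => X Y a'; clear; lia.
(* As [#|I| * a <= h * a <= n / 2], at least half of the vertices stay in [U], and the averaging
   bound yields [n * L <= 16 * h * D < n * L]. *)
have [I [U [iI _ degU]]] := remove_large_degrees [set: T] haD.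
rewrite cardsT -/n => cn.
have := triangle_free_independent e_sym e3 degU LD e_alpha.
have := e_alpha iI.
rewrite prednK // in cn => cI cU.
have Ia : #|I| * a <= h * a by rewrite leq_mul2r cI orbT.
have U2 : n <= 2 * #|U| by move: ha cn Ia; clear; lia.
have : n * L <= 2 * #|U| * L by rewrite leq_mul2r U2 orbT.
have : 0 < n * L by rewrite muln_gt0 L0 andbT (leq_trans _ Pn) ?expn_gt0.
move: hD cU; clear; move: (#|U|) (n * L); lia.
Qed.

End OddGirth.

(** * The deletion method *)

Lemma sum_prod_powerset (R : realFieldType) (E : finType) (A : {set E}) (f : E -> R) :
  (\sum_(J in powerset A) \prod_(i in J) f i = \prod_(i in A) (1 + f i))%R.
Proof.
rewrite [RHS]big_mkcond /=.
(* Outside [A] the factor is written [0 + 1], so index sets not contained in [A] vanish in the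
   expansion. *)
rewrite (eq_bigr (fun i => (if i \in A then f i else 0) + 1)%R); last first.
  by move=> i _; case: ifP => _; rewrite ?add0r // addrC.
rewrite bigA_distr [LHS]big_mkcond /=; apply: eq_bigr => J _; rewrite powersetE.
case: (boolP (J \subset A)) => [JA|/subsetPn[i iJ iA]].
  rewrite [LHS]big_mkcond /=; apply: eq_bigr => i _.
  by case: ifP => // iJ; rewrite (subsetP JA).
by rewrite (bigD1 i) //= iJ (negbTE iA) mul0r.
Qed.

Lemma sum_powerset_exp (R : realFieldType) (E : finType) (A : {set E}) (x : R) :
  (\sum_(J in powerset A) x ^+ #|J| = (1 + x) ^+ #|A|)%R.
Proof.
rewrite -prodr_const -sum_prod_powerset; apply: eq_bigr => J _.
by rewrite prodr_const.
Qed.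

Lemma ler_sum_subset (R : realFieldType) (I : finType) (A B : {set I}) (f : I -> R) :
  A \subset B -> (forall i, 0 <= f i)%R ->
  (\sum_(i in A) f i <= \sum_(i in B) f i)%R.
Proof.
move=> AB f0; rewrite [leRHS](big_setID A) /= (setIidPr AB) lerDl.
by apply: sumr_ge0.
Qed.

Section Deletion.

Variables (R : realFieldType) (E : finType).

(** The bad event: deleting some disjoint family of members of [C] lying in [G] would leave nothing
    of [G] in [B]. *)
Definition destroys (C : {set {set E}}) (B G : {set E}) : bool :=
  [exists F : {set {set E}}, [&& F \subset C, trivIset F, cover F \subset G
    & G :&: B \subset cover F]].

Variables (U : {set E}) (x : R).
Hypothesis x0 : (0 <= x)%R.

(** Such a [G] is determined by [G :\: A], a subset of [U :\: B], and its weight splits as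
    [x ^+ #|A|] times [x ^+ #|G :\: A|]. *)
Lemma sum_prescribed_trace (A B : {set E}) : B \subset U ->
  (\sum_(G in [set G in powerset U | (A \subset G) && (G :&: B \subset A)])
    x ^+ #|G| <= x ^+ #|A| * (1 + x) ^+ (#|U| - #|B|))%R.
Proof.
move=> BU; set D := [set G in _ | _].
have DP G : G \in D -> [/\ G \subset U, A \subset G & G :&: B \subset A].
  by rewrite inE powersetE => /and3P[].
rewrite (eq_bigr (fun G => x ^+ #|A| * x ^+ #|G :\: A|)%R); last first.
  by move=> G /DP[_ AG _]; rewrite -exprD -(cardsID A G) (setIidPr AG).
rewrite -big_distrr /= ler_wpM2l ?exprn_ge0 //.
have inj : {in D &, injective (fun G => G :\: A)}.
  move=> G H /DP[_ AG _] /DP[_ AH _] GH.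
  by rewrite -(setID G A) -(setID H A) GH (setIidPr AG) (setIidPr AH).
rewrite -(big_imset (fun G : {set E} => x ^+ #|G|)%R inj) /=.
have -> : #|U| - #|B| = #|U :\: B| by rewrite cardsD (setIidPr BU).
rewrite -sum_powerset_exp; apply: ler_sum_subset => [|G]; last exact: exprn_ge0.
apply/subsetP => _ /imsetP[G /DP[GU _ GBA] ->]; rewrite powersetE.
apply/subsetP => i; rewrite !inE => /andP[iA iG]; rewrite (subsetP GU) // andbT.
by apply: contra iA => iB; apply: (subsetP GBA); rewrite inE iG.
Qed.

(** Union bound over the disjoint families [F]. Disjointness turns [x ^+ #|cover F|] into a product
    over [F]; dropping it afterwards lets the sum over all [F] factor. *)
Lemma sum_destroyed (C : {set {set E}}) (B : {set E}) : B \subset U ->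
  (\sum_(G in powerset U | destroys C B G) x ^+ #|G| <=
    (1 + x) ^+ (#|U| - #|B|) * \prod_(Z in C) (1 + x ^+ #|Z|))%R.
Proof.
move=> BU.
pose ok (F : {set {set E}}) (G : {set E}) := (cover F \subset G) && (G :&: B \subset cover F).
apply: (@le_trans _ _ (\sum_(F in powerset C | trivIset F)
    \sum_(G in [set G in powerset U | ok F G]) x ^+ #|G|)%R).
  have E1 F : (\sum_(G in [set G in powerset U | ok F G]) x ^+ #|G| =
      \sum_(G in powerset U) if ok F G then x ^+ #|G| else 0)%R.
    by rewrite -big_mkcondr; apply: eq_bigl => G; rewrite inE.
  rewrite (eq_bigr _ (fun F _ => E1 F)) exchange_big big_mkcondr /=.
  apply: ler_sum => G _.
  have w0 F : (0 <= if ok F G then x ^+ #|G| else 0)%R.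
    by case: ifP => // _; apply: exprn_ge0.
  case: ifP => [/existsP[F /and4P[FC tF FG GBF]]|_]; last exact: sumr_ge0.
  rewrite (bigD1 F) ?powersetE ?FC //= /ok FG GBF lerDl; apply: sumr_ge0 => ? _.
  exact: w0.
apply: (@le_trans _ _ (\sum_(F in powerset C | trivIset F)
    (\prod_(Z in F) x ^+ #|Z|) * (1 + x) ^+ (#|U| - #|B|))%R).
  apply: ler_sum => F /andP[_ /eqP tF]; rewrite prodrXr tF.
  exact: sum_prescribed_trace.
rewrite -big_distrl /= mulrC ler_wpM2l ?exprn_ge0 ?addr_ge0 //.
rewrite -(sum_prod_powerset C (fun Z : {set E} => x ^+ #|Z|)%R) big_mkcondr /=.
apply: ler_sum => F _.
by case: ifP => // _; apply: prodr_ge0 => Z _; apply: exprn_ge0.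
Qed.

(* Deleting from G a maximal family of disjoint members of C kills all of C; the
   result can miss B only when the family destroys B. *)
Lemma deletion (J : finType) (P : pred J) (B : J -> {set E}) (C : {set {set E}}) :
  {in P, forall j, B j \subset U} -> set0 \notin C ->
  (\sum_(j | P j) (1 + x) ^+ (#|U| - #|B j|) *
     \prod_(Z in C | ~~ [disjoint Z & B j]) (1 + x ^+ #|Z|) < (1 + x) ^+ #|U|)%R ->
  exists G : {set E}, [/\ G \subset U, {in C, forall Z : {set E}, ~~ (Z \subset G)} &
    {in P, forall j, ~~ [disjoint G & B j]}].
Proof.
move=> BU C0 small; pose CB j := [set Z in C | ~~ [disjoint Z & B j]].
(* First moment: if every [G] were destroyed for some [j], the total weight [(1 + x) ^+ #|U|] would
   be at most the sum in [small]. *)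
have [G GU Gok] : {G | G \in powerset U & forall j, P j -> ~~ destroys (CB j) (B j) G}.
  case: (pickP (fun G => (G \in powerset U) &&
      [forall (j | P j), ~~ destroys (CB j) (B j) G])).
    by move=> G /andP[GU /forall_inP]; exists G.
  move=> none; exfalso; move: small; apply/negP; rewrite -leNgt.
  rewrite -sum_powerset_exp.
  apply: (@le_trans _ _ (\sum_(j | P j)
      \sum_(G in powerset U | destroys (CB j) (B j) G) x ^+ #|G|)%R); last first.
    apply: ler_sum => j Pj.
    rewrite (eq_bigl (fun Z => Z \in CB j)) => [|Z]; last by rewrite [RHS]inE.
    exact/sum_destroyed/BU.
  under [leRHS]eq_bigr do rewrite big_mkcondr.
  rewrite exchange_big /=; apply: ler_sum => G GU.
  have := none G; rewrite GU /= => /negbT.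
  rewrite negb_forall_in => /exists_inP[j Pj /negPn dj].
  rewrite (bigD1 j) //= dj lerDl; apply: sumr_ge0 => i _.
  by case: ifP => // _; apply: exprn_ge0.
pose good (F : {set {set E}}) := [&& F \subset C, trivIset F & cover F \subset G].
have [F /maxsetP[/and3P[FC tF FG] Fmax] _] : {F | maxset good F & set0 \subset F}.
  apply: maxset_exists; rewrite /good sub0set /cover big_set0 sub0set andbT.
  by apply/trivIsetP => A A'; rewrite inE.
rewrite powersetE in GU.
exists (G :\: cover F); split.
- exact: subset_trans (subsetDl _ _) GU.
- move=> Z ZC; apply/negP => ZG.
  have ZF : [disjoint Z & cover F].
    by apply: disjointWl ZG _; rewrite -setI_eq0 setIDAC -setIDA setDv setI0.
  (* By maximality [F] contains [Z], which is thus both inside [cover F] and disjoint from it, hence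
     empty. *)
  have ZinF : Z \in F.
    rewrite -(Fmax (Z |: F)) ?setU11 ?subsetUr //; apply/and3P; split.
    + by rewrite subUset sub1set ZC.
    + apply: trivIsetU => //; first exact: trivIset1.
      by rewrite cover1.
    + rewrite /cover bigcup_setU big_set1 subUset FG andbT.
      exact: subset_trans ZG (subsetDl _ _).
  have : Z \subset cover F by apply: bigcup_sup.
  move/setIidPl; move: ZF; rewrite -setI_eq0 => /eqP -> Z0.
  by rewrite Z0 ZC in C0.
- move=> j Pj; apply: contra (Gok j Pj) => GB.
  have GBF : G :&: B j \subset cover F.
    apply/subsetP => i; rewrite inE => /andP[iG iB]; apply/negPn/negP => iF.
    by have := disjointFl GB iB; rewrite inE iF iG.
  (* The members of [F] that meet [B j] already cover [G :&: B j]. *)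
  apply/existsP; exists (F :&: CB j); apply/and4P; split.
  + exact: subsetIr.
  + exact: trivIsetS (subsetIl _ _) tF.
  + apply: subset_trans FG; apply/bigcupsP => Z; rewrite inE => /andP[ZF _].
    exact: bigcup_sup.
  + apply/subsetP => i iGB; have /bigcupP[Z ZF iZ] := subsetP GBF i iGB.
    apply/bigcupP; exists Z => //; rewrite !inE ZF (subsetP FC) //=.
    apply/negP => /disjointFr/(_ iZ); move: iGB; rewrite inE => /andP[_ ->].
    by [].
Qed.

End Deletion.

Lemma leq_ffact_exp (n k : nat) : n ^_ k <= n ^ k.
Proof. by elim: k => // k IHk; rewrite ffactnSr expnSr leq_mul // leq_subr. Qed.

(** * Cycles of length 3 and 5, and the sparse graph that avoids them *)

Section ShortCycles.

Variable n : nat.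
Implicit Types (u v w a b : 'I_n) (S : {set 'I_n}) (Z : {set {set 'I_n}}).

Definition pairs_in S : {set {set 'I_n}} := [set d : {set 'I_n} | d \subset S & #|d| == 2].

Definition cycle3 (p : 'I_n * 'I_n * 'I_n) : {set {set 'I_n}} :=
  let: (u, v, w) := p in [set [set u; v]; [set v; w]; [set w; u]].

Definition cycle5 (p : 'I_n * 'I_n * ('I_n * 'I_n * 'I_n)) : {set {set 'I_n}} :=
  let: (u, v, (a, b, c)) := p in
  [set [set u; v]; [set v; a]; [set a; b]; [set b; c]; [set c; u]].

(** The size conditions fix the weight of a member as [x ^+ 3] or [x ^+ 5]; cycles with distinct
    vertices satisfy them. *)
Definition short_cycles : {set {set {set 'I_n}}} :=
  [set Z | (Z \in codom cycle3) && (#|Z| == 3) || (Z \in codom cycle5) && (#|Z| == 5)].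

Lemma cycle3_rot u v w : cycle3 (u, v, w) = cycle3 (v, w, u).
Proof. by apply/setP => d; rewrite !inE; do 3!case: (d == _). Qed.

Lemma cycle5_rot u v a b c : cycle5 (u, v, (a, b, c)) = cycle5 (v, a, (b, c, u)).
Proof. by apply/setP => d; rewrite !inE; do 5!case: (d == _). Qed.

(** After a rotation the pair inside [S] comes first: two vertices are chosen in [S] and the third
    one is free. For 5-cycles, three vertices are free. *)
Lemma card_cycles3_meeting S :
  #|[set Z in short_cycles | ~~ [disjoint Z & pairs_in S] & #|Z| == 3]| <= #|S| ^ 2 * n.
Proof.
pose D := setX (setX S S) [set: 'I_n].
apply: (@leq_trans #|cycle3 @: D|); last first.
  by apply: leq_trans (leq_imset_card _ _) _; rewrite !cardsX cardsT card_ord.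
apply: subset_leq_card; apply/subsetP => Z; rewrite 2!inE => /andP[ZC /andP[mZ /eqP Z3]].
move: ZC; rewrite Z3 /= andbT andbF orbF => /codomP[[[u v] w] ZE].
have base u' v' w' : [set u'; v'] \in pairs_in S -> cycle3 (u', v', w') \in cycle3 @: D.
  rewrite inE subUset !sub1set => /andP[/andP[uS vS] _].
  by apply: imset_f; rewrite !inE uS vS.
move: mZ; rewrite -setI_eq0 => /set0Pn[d]; rewrite inE ZE => /andP[].
rewrite {1}/cycle3 !in_setU !in_set1 => /orP[/orP[]|] /eqP -> dS.
- exact: base.
- by rewrite cycle3_rot; apply: base.
- by rewrite 2!cycle3_rot; apply: base.
Qed.

Lemma card_cycles5_meeting S :
  #|[set Z in short_cycles | ~~ [disjoint Z & pairs_in S] & #|Z| != 3]| <=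
    #|S| ^ 2 * n ^ 3.
Proof.
pose D := setX (setX S S) [set: 'I_n * 'I_n * 'I_n].
apply: (@leq_trans #|cycle5 @: D|); last first.
  apply: leq_trans (leq_imset_card _ _) _.
  by rewrite !cardsX cardsT !card_prod card_ord (expnSr n 2).
apply: subset_leq_card; apply/subsetP => Z; rewrite 2!inE => /andP[ZC /andP[mZ Z3]].
move: ZC; rewrite (negbTE Z3) andbF /= => /andP[/codomP[[[u v] [[a b] c]] ZE] _].
have base u' v' a' b' c' : [set u'; v'] \in pairs_in S ->
    cycle5 (u', v', (a', b', c')) \in cycle5 @: D.
  rewrite inE subUset !sub1set => /andP[/andP[uS vS] _].
  by apply: imset_f; rewrite !inE uS vS.
move: mZ; rewrite -setI_eq0 => /set0Pn[d]; rewrite inE ZE => /andP[].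
rewrite {1}/cycle5 !in_setU !in_set1 => /orP[/orP[/orP[/orP[]|]|]|] /eqP -> dS.
- exact: base.
- by rewrite cycle5_rot; apply: base.
- by rewrite 2!cycle5_rot; apply: base.
- by rewrite 3!cycle5_rot; apply: base.
- by rewrite 4!cycle5_rot; apply: base.
Qed.

Lemma pair_neq u v a b : (u != a) && (u != b) || (v != a) && (v != b) ->
  [set u; v] != [set a; b].
Proof.
move=> h; apply/eqP => /setP E; move: h (E u) (E v).
by rewrite !inE !eqxx orbT /= -!negb_or => /orP[] /negbTE ->.
Qed.

Lemma card_cycle3 u v w : uniq [:: u; v; w] -> #|cycle3 (u, v, w)| = 3.
Proof.
move=> uq; have -> : cycle3 (u, v, w) =
    [set d in [:: [set u; v]; [set v; w]; [set w; u]]].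
  by apply/setP => d; rewrite !inE orbA.
rewrite cardsE; apply/card_uniqP; move: uq; rewrite /= !inE !negb_or !andbT.
move=> /andP[/andP[uv uw] vw]; have sym := (eq_sym v u, eq_sym w u, eq_sym w v).
by rewrite !pair_neq // ?sym ?uv ?uw ?vw ?orbT.
Qed.

Lemma card_cycle5 u v a b c :
  uniq [:: u; v; a; b; c] -> #|cycle5 (u, v, (a, b, c))| = 5.
Proof.
move=> uq; have -> : cycle5 (u, v, (a, b, c)) =
    [set d in [:: [set u; v]; [set v; a]; [set a; b]; [set b; c]; [set c; u]]].
  by apply/setP => d; rewrite !inE !orbA.
rewrite cardsE; apply/card_uniqP; move: uq; rewrite /= !inE !negb_or !andbT -!andbA.
case/and5P=> uv ua ub uc /and5P[va vb vc ab /andP[ac bc]].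
have sym := (eq_sym v u, eq_sym a u, eq_sym b u, eq_sym c u, eq_sym a v, eq_sym b v,
  eq_sym c v, eq_sym b a, eq_sym c a, eq_sym c b).
by rewrite !pair_neq // ?sym ?uv ?ua ?ub ?uc ?va ?vb ?vc ?ab ?ac ?bc ?orbT.
Qed.

Section Avoiding.

Variable G : {set {set 'I_n}}.
Hypothesis G2 : G \subset pairs_in setT.
Hypothesis Gshort : {in short_cycles, forall Z, ~~ (Z \subset G)}.

Let e u v : bool := [set u; v] \in G.

Let e_sym : symmetric e.
Proof. by move=> u v; rewrite /e setUC. Qed.

Let e_neq u v : e u v -> u != v.
Proof.
move=> /(subsetP G2); rewrite inE => /andP[_].
by apply: contraTneq => ->; rewrite setUid cards1.
Qed.

Lemma avoiding3 u v w : e u v -> e v w -> ~~ e u w.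
Proof.
move=> uv vw; apply/negP => uw; rewrite e_sym in uw.
have := @Gshort (cycle3 (u, v, w)); rewrite inE codom_f card_cycle3 /=; last first.
  by rewrite !inE negb_or (e_neq uv) (e_neq vw) eq_sym (e_neq uw).
by rewrite /cycle3 !subUset !sub1set; move: uv vw uw; rewrite /e => -> -> -> /(_ isT).
Qed.

(** In the absence of triangles, a closed walk of length 5 has five distinct vertices, so its edges
    form a member of [short_cycles]. *)
Lemma avoiding5 u v a b c : e u v -> e v a -> e a b -> e b c -> ~~ e u c.
Proof.
move=> uv va ab bc; apply/negP => uc; rewrite e_sym in uc.
have far x y z : e x y -> e y z -> ~~ e z x.
  by move=> xy yz; rewrite e_sym; apply: avoiding3 yz.
(* If [x = z], cutting out the detour through [y] leaves a closed walk of length 3. *)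
have neq2 x y z w t : e x y -> e y z -> e z w -> e w t -> e t x -> x != z.
  move=> xy yz zw wt tx; apply/eqP => xz; rewrite -xz in zw.
  by have := far _ _ _ zw wt; rewrite tx.
have := @Gshort (cycle5 (u, v, (a, b, c))).
rewrite inE codom_f card_cycle5 ?orbT /=; last first.
  rewrite !inE !negb_or (e_neq uv) (e_neq va) (e_neq ab) (e_neq bc).
  rewrite (neq2 u v a b c) // (neq2 v a b c u) // (neq2 a b c u v) //.
  by rewrite eq_sym (neq2 b c u v a) // eq_sym (e_neq uc) eq_sym (neq2 c u v a b).
rewrite /cycle5 !subUset !sub1set; move: uv va ab bc uc; rewrite /e.
by move=> -> -> -> -> -> /(_ isT).
Qed.

End Avoiding.

(** The deletion method is applied to the sets [pairs_in S] with [#|S| = k]. There are at most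
    [n ^ k] of them, and each meets at most [k ^ 2 * n] triangles and [k ^ 2 * n ^ 3] 5-cycles. *)
Lemma sparse_graph (R : realFieldType) (k : nat) (x : R) : (0 <= x)%R ->
  ((n ^ k)%:R * ((1 + x ^+ 3) ^+ (k ^ 2 * n) * (1 + x ^+ 5) ^+ (k ^ 2 * n ^ 3))
     < (1 + x) ^+ 'C(k, 2))%R ->
  exists e : rel 'I_n, [/\ symmetric e,
    forall u v w, e u v -> e v w -> ~~ e u w,
    forall u v a b c, e u v -> e v a -> e a b -> e b c -> ~~ e u c &
    forall A : {set 'I_n}, independent e A -> #|A| <= k].
Proof.
move=> x0 small; have [nk|/ltnW kn] := leqP n k.
  exists (fun _ _ => false); split=> // A _.
  by rewrite (leq_trans (max_card _)) ?card_ord.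
have cB S : #|pairs_in S| = 'C(#|S|, 2) by apply: cards_draws.
have BU S : pairs_in S \subset pairs_in setT.
  by apply/subsetP => d; rewrite !inE subsetT => /andP[].
have [||G [GU G_short G_meets]] := @deletion R _ (pairs_in setT) x x0 _
   [pred S : {set 'I_n} | #|S| == k] pairs_in short_cycles (fun S _ => BU S).
- by rewrite inE cards0 !andbF.
- apply: (@le_lt_trans _ _ (\sum_(S : {set 'I_n} | #|S| == k)
    (1 + x) ^+ (#|pairs_in setT| - 'C(k, 2)) *
     ((1 + x ^+ 3) ^+ (k ^ 2 * n) * (1 + x ^+ 5) ^+ (k ^ 2 * n ^ 3)))%R).
    apply: ler_sum => S /eqP Sk; rewrite (cB S) Sk ler_wpM2l ?exprn_ge0 ?addr_ge0 //.
    rewrite (bigID (fun Z => #|Z| == 3)) /=; apply: ler_pM.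
    + by apply: prodr_ge0 => Z _; rewrite addr_ge0 ?exprn_ge0.
    + by apply: prodr_ge0 => Z _; rewrite addr_ge0 ?exprn_ge0.
    + rewrite (eq_bigr (fun=> 1 + x ^+ 3)%R) => [|Z /andP[_ /eqP ->] //].
      rewrite (eq_bigl (mem [set Z in short_cycles |
        ~~ [disjoint Z & pairs_in S] & #|Z| == 3])); last first.
        by move=> Z; rewrite !inE andbA.
      rewrite prodr_const; apply: ler_weXn2l; first by rewrite lerDl exprn_ge0.
      by rewrite -{1}Sk; apply: card_cycles3_meeting.
    + rewrite (eq_bigr (fun=> 1 + x ^+ 5)%R); last first.
        move=> Z /andP[/andP[+ _] /negbTE Z3].
        by rewrite inE Z3 andbF /= => /andP[_ /eqP ->].
      rewrite (eq_bigl (mem [set Z in short_cycles |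
        ~~ [disjoint Z & pairs_in S] & #|Z| != 3])); last first.
        by move=> Z; rewrite !inE andbA.
      rewrite prodr_const; apply: ler_weXn2l; first by rewrite lerDl exprn_ge0.
      by rewrite -{1}Sk; apply: card_cycles5_meeting.
  rewrite sumr_const (@eq_card _ _ (mem [set A : {set 'I_n} | #|A| == k])); last first.
    by move=> A; rewrite [RHS]inE.
  rewrite card_draws card_ord -mulr_natl mulrCA.
  have -> : ((1 + x) ^+ #|pairs_in setT| =
      (1 + x) ^+ (#|pairs_in setT| - 'C(k, 2)) * (1 + x) ^+ 'C(k, 2))%R.
    by rewrite -exprD cB cardsT card_ord subnK // leq_bin2l.
  rewrite ltr_pM2l ?exprn_gt0 ?ltr_wpDr //; apply: le_lt_trans small.
  rewrite ler_wpM2r ?mulr_ge0 ?exprn_ge0 ?addr_ge0 ?exprn_ge0 // ler_nat.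
  apply: (@leq_trans (n ^_ k)); last exact: leq_ffact_exp.
  by rewrite -bin_ffact leq_pmulr // fact_gt0.
exists (fun u v => [set u; v] \in G); split.
- by move=> u v; rewrite setUC.
- exact: avoiding3.
- exact: avoiding5.
- move=> A iA; rewrite leqNgt; apply/negP => kA.
  (* A set of more than [k] vertices contains a [k]-set, and [G] has an edge inside every
     [k]-set. *)
  have [S SA Sk] : exists2 S : {set 'I_n}, S \subset A & #|S| == k.
    have : 0 < #|[set S : {set 'I_n} | S \subset A & #|S| == k]|.
      by rewrite cards_draws bin_gt0 ltnW.
    by case/card_gt0P => S; rewrite inE => /andP[]; exists S.
  have := G_meets S Sk; rewrite -setI_eq0 => /set0Pn[d].
  rewrite !inE => /and3P[dG dS /cards2P[u [v [uv dE]]]].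
  move: dS; rewrite dE subUset !sub1set => /andP[/(subsetP SA) uA /(subsetP SA) vA].
  by have /independentP/(_ u v uA vA) := iA; rewrite -dE dG.
Qed.

End ShortCycles.

(** * Colorings and their red graphs *)

Notation forbidden :=
  [fset [mset Red; Red; Red]%mset; [mset Red; Red; Blue]%mset;
        [mset Yellow; Yellow; Red]%mset]%fset.

Definition forbidden_triple (x y z : color) : bool :=
  let s := [:: x; y; z] in
  [|| perm_eq s [:: Red; Red; Red], perm_eq s [:: Red; Red; Blue]
    | perm_eq s [:: Yellow; Yellow; Red]].

Lemma in_fset3 (K : choiceType) (x a b c : K) :
  (x \in [fset a; b; c]%fset) = [|| x == a, x == b | x == c].
Proof. by rewrite !in_fsetU !in_fset1 orbA. Qed.

Lemma mem_forbidden (x y z : color) :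
  (seq_mset [:: x; y; z] \in forbidden) = forbidden_triple x y z.
Proof.
have E (a b c : color) : [mset a; b; c]%mset = seq_mset [:: a; b; c].
  apply/msetP => i; rewrite mset_seqE /= !msetE2 !msetnE addn0.
  rewrite !(eq_sym i).
  by case: (a == i); case: (b == i); case: (c == i).
have eqE s t : (seq_mset s == seq_mset t :> multiset color) = perm_eq s t.
  by apply/eqP/idP => /eq_seq_msetP.
rewrite in_fset3.
rewrite (E Red Red Red) (E Red Red Blue) (E Yellow Yellow Red).
by rewrite !eqE /forbidden_triple.
Qed.

Section PairColor.

Variables (n : nat) (c : coloring n).

(* The value [Yellow] on the diagonal is arbitrary. *)
Definition pair_color (u v : 'I_n) : color :=
  odflt Yellow (omap c (insub [set u; v])).

Lemma pair_colorC (u v : 'I_n) : pair_color u v = pair_color v u.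
Proof. by rewrite /pair_color setUC. Qed.

Lemma pair_colorE (u v : 'I_n) (e : edge n) :
  val e = [set u; v] -> pair_color u v = c e.
Proof. by rewrite /pair_color => <-; rewrite valK. Qed.

Lemma edge_of_pair (u v : 'I_n) : u != v ->
  exists2 e : edge n, val e = [set u; v] & pair_color u v = c e.
Proof.
move=> uv; have uv2 : #|[set u; v]| == 2 by rewrite cards2 uv.
by exists (exist _ [set u; v] uv2) => //; apply: pair_colorE.
Qed.

Lemma edge_pair (e : edge n) : exists u v,
  [/\ u != v, val e = [set u; v] & pair_color u v = c e].
Proof.
have /cards2P[u [v [uv ve]]] := valP e.
by exists u, v; split=> //; apply: pair_colorE.
Qed.

Lemma pattern_of_triple (u v w : 'I_n) : u != v -> v != w -> u != w ->
  pattern_of c [set u; v; w] =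
  seq_mset [:: pair_color u v; pair_color v w; pair_color u w].
Proof.
move=> uv vw uw.
have [e1 e1E ->] := edge_of_pair uv.
have [e2 e2E ->] := edge_of_pair vw.
have [e3 e3E ->] := edge_of_pair uw.
apply/eq_seq_msetP; rewrite -[X in perm_eq _ X]/(map c [:: e1; e2; e3]).
apply: perm_map; apply: uniq_perm; first exact: enum_uniq.
  have neq (e f : edge n) (x : 'I_n) : x \in val e -> x \notin val f -> e != f.
    by move=> xe; apply: contra => /eqP <-.
  rewrite /= !inE !negb_or (neq e1 e2 u) ?(neq e1 e3 v) ?(neq e2 e3 v) //;
    rewrite ?e1E ?e2E ?e3E !inE ?eqxx ?orbT ?negb_or //.
  - by rewrite eq_sym uv vw.
  - by rewrite eq_sym uv vw.
  - by rewrite uv uw.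
move=> e; rewrite mem_enum !inE; apply/idP/idP; last first.
  case/or3P => /eqP ->; rewrite ?e1E ?e2E ?e3E subUset !sub1set !inE !eqxx ?orbT //.
have [x [y [xy eE _]]] := edge_pair e.
have eqe f : (e == f) = (val e == val f) by rewrite val_eqE.
rewrite !eqe eE e1E e2E e3E subUset !sub1set !inE.
move=> /andP[/orP[/orP[]|] /eqP def_x /orP[/orP[]|] /eqP def_y];
  move: xy; rewrite def_x def_y ?eqxx // => _;
  by [rewrite ?eqxx ?orbT ?orbT | rewrite setUC eqxx ?orbT ?orbT].
Qed.

Lemma ForbP : reflect
  (forall u v w, u != v -> v != w -> u != w ->
    ~~ forbidden_triple (pair_color u v) (pair_color v w) (pair_color u w))
  (c \in Forb n forbidden).
Proof.
rewrite inE; apply: (iffP forallP) => [h u v w uv vw uw | h T].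
  have := h [set u; v; w]; rewrite pattern_of_triple // mem_forbidden.
  move/implyP; apply; rewrite cardsU cards2 uv cards1.
  rewrite (_ : _ :&: _ = set0) ?cards0 //.
  apply/setP => x; rewrite !inE; apply/negbTE; apply/negP.
  by case/andP => /orP[]/eqP -> ; apply/negP.
apply/implyP => T3.
have /card_gt0P[u uT] : 0 < #|T| by rewrite (eqP T3).
have : #|T :\ u| == 2 by move: T3; rewrite (cardsD1 u) uT.
case/cards2P => v [w [vw TE]].
have := setD11 u T; rewrite TE !inE => /negbT; rewrite negb_or => /andP[uv uw].
have -> : T = [set u; v; w] by rewrite -(setD1K uT) TE setUA.
by rewrite pattern_of_triple // mem_forbidden h.
Qed.

(** There are exactly three colors, so using at most two of them amounts to missing one. *)
Lemma two_colors (S : {set 'I_n}) :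
  (#|[set c e | e in edges_in S]| <= 2) <->
  exists x, {in S &, forall u v, u != v -> pair_color u v != x}.
Proof.
have card_color : #|{: color}| = 3.
  rewrite -(card_ord 3); apply: (bij_eq_card (f := ord_of_color)).
  exists color_of_ord; first exact: ord_of_colorK.
  by case=> [[|[|[|//]]] i3]; apply: val_inj.
split=> [le2|[x hx]].
  have /card_gt0P[x] : 0 < #|~: [set c e | e in edges_in S]|.
    by rewrite cardsCs setCK card_color subn_gt0.
  rewrite inE => xC; exists x => u v uS vS uv.
  apply: contra xC => /eqP <-; have [e eE ->] := edge_of_pair uv.
  by apply: imset_f; rewrite inE eE subUset !sub1set uS.
rewrite -ltnS -card_color -cardsT; apply: proper_card.
rewrite properE subsetT /=; apply/subsetPn; exists x => //.
apply/imsetP => -[e]; rewrite inE; have [u [v [uv -> <-]]] := edge_pair e.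
rewrite subUset !sub1set => /andP[uS vS] xE.
by have := hx u v uS vS uv; rewrite xE eqxx.
Qed.

Lemma h2_col_ge (S : {set 'I_n}) (x : color) :
  {in S &, forall u v, u != v -> pair_color u v != x} -> #|S| <= h2_col c.
Proof.
move=> hx; apply: leq_bigmax_cond; rewrite (two_colors S).2 //.
by exists x.
Qed.

Lemma h2_col_le (m : nat) :
  (forall (S : {set 'I_n}) (x : color),
    {in S &, forall u v, u != v -> pair_color u v != x} -> #|S| <= m) ->
  h2_col c <= m.
Proof. by move=> hm; apply/bigmax_leqP => S /two_colors[x]; apply: hm. Qed.

End PairColor.

Section Lower.

Variables (n : nat) (c : coloring n).
Hypothesis cF : c \in Forb n forbidden.

Let red (u v : 'I_n) : bool := (u != v) && (pair_color c u v == Red).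

(** The ends of a red path of length two form a yellow pair, as [rrr] and [rrb] are excluded. In a
    red walk [u, v, a, b, d] the pairs [a u] and [a d] are therefore yellow, and excluding [yyr]
    keeps [u d] from being red. *)
Lemma h2_col_lower (L : nat) : 2 ^ (4 * L) <= n ->
  n ^ 2 * L <= 2 ^ 15 * h2_col c ^ 3.
Proof.
have red_sym : symmetric red by move=> u v; rewrite /red eq_sym pair_colorC.
have good := elimT (ForbP c) cF.
have red_irr u : red u u = false by rewrite /red eqxx.
have redP u v : red u v -> u != v /\ pair_color c u v = Red.
  by move=> /andP[-> /eqP].
have red2 u v w : red u v -> red v w -> u != w -> pair_color c u w = Yellow.
  move=> /redP[uv uvR] /redP[vw vwR] uw; have := good _ _ _ uv vw uw.
  by rewrite uvR vwR; case: pair_color.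
have yred u v w : pair_color c u v = Yellow -> pair_color c u w = Yellow ->
    u != v -> u != w -> ~~ red v w.
  move=> uvY uwY uv uw; apply/negP => /redP[vw vwR].
  by have := good _ _ _ uv vw uw; rewrite uvY vwR uwY.
have red3 u v w : red u v -> red v w -> ~~ red u w.
  move=> uv vw; apply/negP => uw; have [uw' uwR] := redP _ _ uw.
  by have := red2 _ _ _ uv vw uw'; rewrite uwR.
have red5 u v a b d : red u v -> red v a -> red a b -> red b d -> ~~ red u d.
  move=> uv va ab bd; have vu : red v u by rewrite red_sym.
  (* If [a] is [u] or [d], the walk shortens to a red path of length two from [u] to [d]. *)
  case: (eqVneq a u) => [au|au].
    by rewrite -au; apply: red3 bd.
  case: (eqVneq a d) => [ad|ad].
    by rewrite -ad; apply: red3 va.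
  apply: (yred a); rewrite // ?(red2 _ _ _ ab bd ad) //.
  by apply: (red2 _ v) => //; rewrite red_sym.
rewrite -{1 2}(card_ord n); apply: (odd_girth_independent red_sym red3 red5) => A.
move=> /independentP iA; apply: (h2_col_ge (x := Red)) => u v uA vA uv.
by have := iA u v uA vA; rewrite /red uv.
Qed.

End Lower.

Section Upper.

Variables (n : nat) (e : rel 'I_n) (m : nat).
Hypotheses (e_sym : symmetric e) (e3 : forall u v w, e u v -> e v w -> ~~ e u w).
Hypothesis e5 : forall u v a b c, e u v -> e v a -> e a b -> e b c -> ~~ e u c.
Hypothesis e_alpha : forall A : {set 'I_n}, independent e A -> #|A| <= m.

Let e_irr u : ~~ e u u.
Proof. by apply/negP => euu; have := e3 euu euu; rewrite euu. Qed.

Definition common_nbr (u v : 'I_n) : bool := [exists w, e u w && e w v].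

Definition square_color (u v : 'I_n) : color :=
  if e u v then Red else if common_nbr u v then Yellow else Blue.

Lemma common_nbr_sym : symmetric common_nbr.
Proof.
by move=> u v; apply: eq_existsb => w; rewrite e_sym [e w v]e_sym andbC.
Qed.

Lemma square_colorC (u v : 'I_n) : square_color u v = square_color v u.
Proof. by rewrite /square_color e_sym common_nbr_sym. Qed.

(** The ordered pair picked for an edge is immaterial since [square_color] is symmetric; every edge
    is a pair, so the default [Blue] is never reached. *)
Definition square_coloring : coloring n :=
  [ffun d : edge n => if [pick p : 'I_n * 'I_n | val d == [set p.1; p.2]] is Some p
     then square_color p.1 p.2 else Blue].

Lemma pair_square_color (u v : 'I_n) : u != v ->
  pair_color square_coloring u v = square_color u v.
Proof.
move=> uv; have [d dE ->] := edge_of_pair square_coloring uv.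
rewrite ffunE; case: pickP => [[x y] /= /eqP|/(_ (u, v))]; last by rewrite /= dE eqxx.
rewrite dE => /setP uvE.
have := uvE u; have := uvE v; rewrite !inE !eqxx orbT /=.
move=> /esym/orP[] /eqP vx /esym/orP[] /eqP ux; move: uv; rewrite ux vx ?eqxx //.
by rewrite square_colorC.
Qed.

(** Two red edges force a yellow third one, which excludes [rrr] and [rrb]. Two yellow pairs closed
    by a red edge would give a closed walk of length 5, which excludes [yyr]. *)
Lemma square_coloring_Forb : square_coloring \in Forb n forbidden.
Proof.
apply/ForbP => u v w uv vw uw; rewrite !pair_square_color //.
have P3 a b d : e a b -> e b d -> square_color a d = Yellow.
  move=> ab bd; rewrite /square_color (negbTE (e3 ab bd)) /common_nbr.
  by case: existsP => // -[]; exists b; rewrite ab.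
have YY a b d : common_nbr a b -> common_nbr b d -> ~~ e a d.
  by move=> /existsP[x /andP[ax xb]] /existsP[y /andP[bly yd]]; apply: e5 ax xb bly yd.
have sC := common_nbr_sym.
case euv : (e u v); case evw : (e v w); case euw : (e u w).
- by have := e3 euv evw; rewrite euw.
- by rewrite (P3 _ _ _ euv evw) /square_color euv evw.
- by rewrite e_sym in euv; rewrite (P3 _ _ _ euv euw) /square_color e_sym euv euw.
- rewrite /square_color euv evw euw.
  case vw' : (common_nbr v w); case uw' : (common_nbr u w) => //.
  by have := YY _ _ _ uw' (etrans (sC _ _) vw'); rewrite euv.
- by rewrite e_sym in evw; rewrite (P3 _ _ _ euw evw) /square_color [e v w]e_sym evw euw.
- rewrite /square_color euv evw euw.
  case uv' : (common_nbr u v); case uw' : (common_nbr u w) => //.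
  by have := YY _ _ _ (etrans (sC _ _) uv') uw'; rewrite evw.
- rewrite /square_color euv evw euw.
  case uv' : (common_nbr u v); case vw' : (common_nbr v w) => //.
  by have := YY _ _ _ uv' vw'; rewrite euw.
- rewrite /square_color euv evw euw.
  by do 3!case: common_nbr.
Qed.

Lemma h2_col_square : h2_col square_coloring <= m.*2.+1.
Proof.
apply: h2_col_le => S [] hS.
- apply: (@leq_trans m); last by lia.
  apply: e_alpha; apply/independentP => u v uS vS.
  case: (eqVneq u v) => [->|uv]; first exact: e_irr.
  by have := hS u v uS vS uv; rewrite pair_square_color // /square_color; case: (e u v).
(* Without blue pairs, [S] consists of a vertex [v], its neighbours and its second neighbours; both
   of these sets are independent, and [v] accounts for the extra 1. *)
- have [->|[v vS]] := set_0Vmem S; first by rewrite cards0.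
  have -> : S = v |: (nbhd e S v :|: [set w in S :\ v | common_nbr v w]).
    apply/setP => w; rewrite !inE; case: (eqVneq w v) => [-> //|wv] /=.
    case wS : (w \in S) => //=; rewrite eq_sym in wv.
    have := hS v w vS wS wv; rewrite pair_square_color // /square_color.
    by case: (e v w); case: common_nbr.
  rewrite cardsU1; apply: (@leq_trans (1 + (m + m))); last by lia.
  apply: leq_add; first by case: (_ \notin _).
  rewrite cardsU; apply: leq_trans (leq_subr _ _) _; apply: leq_add.
    exact/e_alpha/nbhd_independent.
  apply: e_alpha; apply/independentP => x y; rewrite !inE.
  move=> /andP[_ /existsP[a /andP[va ax]]] /andP[_ /existsP[b /andP[vb yb]]].
  rewrite e_sym in va; rewrite e_sym in ax.
  exact: e5 ax va vb yb.
- (* Without yellow pairs every vertex has at most one neighbour in S. *)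
  have one x y z : y \in S -> z \in S -> e x y -> e x z -> y = z.
    move=> yS zS xy xz; apply/eqP/negPn/negP => yz; rewrite e_sym in xy.
    have := hS y z yS zS yz; rewrite pair_square_color // /square_color.
    rewrite (negbTE (e3 xy xz)) /common_nbr.
    by case: existsP => // -[]; exists x; rewrite xy.
  have [T] : {T | maxset (fun A : {set 'I_n} => (A \subset S) && independent e A) T
      & set0 \subset T}.
    apply: maxset_exists; rewrite sub0set; apply/independentP => x y.
    by rewrite inE.
  move=> /maxsetP[/andP[TS iT] Tmax] _.
  have nbr x : x \in S :\: T -> {t | t \in T & e x t}.
    rewrite inE => /andP[xT xS]; case: (pickP (fun t => (t \in T) && e x t)).
      by move=> t /andP[tT xt]; exists t.
    move=> noT; exfalso; move/negP: xT; apply; rewrite -(Tmax (x |: T)) ?setU11 //.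
      rewrite subUset sub1set xS TS; apply/independentP => y z.
      rewrite !inE => /orP[/eqP->|yT] /orP[/eqP->|zT]; first exact: e_irr.
      - by have := noT z; rewrite zT /= => ->.
      - by have := noT y; rewrite yT /= e_sym => ->.
      - by move/independentP: iT; apply.
    exact: subsetUr.
  have Tm := e_alpha iT.
  (* By maximality each vertex of [S :\: T] has a neighbour in [T], and distinct vertices have
     distinct ones because a vertex has at most one neighbour in [S]. *)
  have ST : #|S :\: T| <= #|T|.
    have inj : {in S :\: T &, injective (fun x => odflt x [pick t in T | e x t])}.
      move=> x y xS yS; have [t tT xt] := nbr _ xS; have [s sT ys] := nbr _ yS.
      case: pickP => [t' /andP[t'T xt']|/(_ t)]; last by rewrite /= tT xt.
      case: pickP => [s' /andP[s'T ys']|/(_ s)]; last by rewrite /= sT ys.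
      move=> /= ts; rewrite -ts in ys'.
      apply: (one t'); rewrite 1?e_sym //.
        by move: xS; rewrite inE => /andP[].
      by move: yS; rewrite inE => /andP[].
    rewrite -(card_in_imset inj); apply: subset_leq_card; apply/subsetP => t.
    case/imsetP => x xS ->; have [s sT xs] := nbr _ xS.
    by case: pickP => [s' /andP[] //|/(_ s)]; rewrite sT xs.
  have := cardsID T S; rewrite (setIidPr TS); lia.
Qed.

End Upper.

(** * Bounds on [h2] for a fixed number of vertices *)

Lemma h2_lower (n L : nat) : 2 ^ (4 * L) <= n ->
  n ^ 2 * L <= 2 ^ 15 * h2 n forbidden ^ 3.
Proof.
move=> nL; rewrite /h2; apply: (big_ind (fun x => n ^ 2 * L <= 2 ^ 15 * x ^ 3)) => [|x y hx hy|c cF].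
(* The neutral element [n] of the minimum must satisfy the bound too; this follows from [L <= n]. *)
- have LP : L <= n.
    apply: leq_trans nL; apply: leq_trans (ltnW (ltn_expl _ (isT : 1 < 2))).
    by rewrite leq_pmull.
  rewrite (expnS n 2) (mulnC n) mulnA; apply: leq_mul => //.
  by rewrite leq_pmull // expn_gt0.
- by rewrite /minn; case: ifP.
- exact: h2_col_lower.
Qed.

Lemma h2_upper (n m : nat) (e : rel 'I_n) : symmetric e ->
  (forall u v w, e u v -> e v w -> ~~ e u w) ->
  (forall u v a b c, e u v -> e v a -> e a b -> e b c -> ~~ e u c) ->
  (forall A : {set 'I_n}, independent e A -> #|A| <= m) ->
  h2 n forbidden <= m.*2.+1.
Proof.
move=> e_sym e3 e5 hm; apply: leq_trans (h2_col_square e_sym e3 e5 hm).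
have cF := square_coloring_Forb e_sym e3 e5.
rewrite /h2; elim: (index_enum _) (mem_index_enum (square_coloring e)) => // c s IHs.
rewrite inE big_cons => /predU1P[<-|/IHs]; first by rewrite cF geq_minl.
by case: ifP => // _; apply: leq_trans; apply: geq_minr.
Qed.

(** * Asymptotics *)

Local Open Scope ring_scope.

Section Estimates.

Variable R : realType.

Lemma expr1D_le_expR (y : R) (m : nat) : 0 <= y -> (1 + y) ^+ m <= expR (m%:R * y).
Proof.
move=> y0; rewrite expRM_natl; apply: lerXn2r; rewrite ?nnegrE ?addr_ge0 ?expR_ge0 //.
exact: expR_ge1Dx.
Qed.

(** From [expR (- (y / 2)) >= 1 - y / 2] and [(1 + y) * (1 - y / 2) >= 1], the latter valid for
    [0 <= y <= 1]. *)
Lemma expR_le_expr1D (y : R) (m : nat) :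
  0 <= y <= 1 -> expR (m%:R * (y / 2)) <= (1 + y) ^+ m.
Proof.
move=> /andP[y0 y1]; rewrite expRM_natl.
apply: lerXn2r; rewrite ?nnegrE ?addr_ge0 ?expR_ge0 //.
have := expR_ge1Dx (- (y / 2)); have := expRxMexpNx_1 (y / 2).
have := expR_gt0 (y / 2); set a := expR _; set b := expR (- _) => a0 ab1 b1.
have : a * (1 - y / 2) <= 1 by rewrite -[leRHS]ab1 ler_wpM2l // ltW.
nra.
Qed.

(** After taking exponentials, everything is compared with [k ^ 2 * x]: the choice of sets costs at
    most 1/16 of it, the triangles 1/64, the 5-cycles 1/4096, while the right side is worth at least
    1/8. The 5-cycles dictate [x] of order [n ^ (-3/4)], which keeps [n ^ 3 * x ^ 4] constant. *)
Lemma deletion_condition (n k : nat) (s x : R) : (1 < n)%N -> (1 < k)%N -> 0 < s ->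
  s ^+ 4 = n%:R -> 128 * s ^+ 3 * ln n%:R <= k%:R ->
  x = (8 * s ^+ 3)^-1 ->
  (n ^ k)%:R * ((1 + x ^+ 3) ^+ (k ^ 2 * n) * (1 + x ^+ 5) ^+ (k ^ 2 * n ^ 3)) <
    (1 + x) ^+ 'C(k, 2).
Proof.
move=> n1 k1 s0 sn sk xE.
have s1 : 1 <= s.
  rewrite leNgt; apply/negP => s1; have : s ^+ 4 < 1 by rewrite exprn_ilt1 // ltW.
  by rewrite sn ltrn1; lia.
have x0 : 0 < x by rewrite xE invr_gt0 mulr_gt0 ?exprn_gt0.
have s3 : 1 <= s ^+ 3 by rewrite exprn_ege1.
have x1 : x <= 1 by rewrite xE invf_le1; nra.
have n0 : 0 < n%:R :> R by rewrite ltr0n; lia.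
set l := ln n%:R in sk.
have nl : n%:R = expR l :> R by rewrite /l lnK.
have l0 : 0 <= l by rewrite ln_ge0 // ler1n; lia.
apply: (@lt_le_trans _ _ (expR ('C(k, 2)%:R * (x / 2)))); last first.
  by apply: expR_le_expr1D; rewrite ltW.
apply: (@le_lt_trans _ _ (expR (k%:R * l + ((k ^ 2 * n)%:R * x ^+ 3 +
    (k ^ 2 * n ^ 3)%:R * x ^+ 5)))).
  rewrite !expRD; apply: ler_pM => //.
  - by rewrite mulr_ge0 ?exprn_ge0 ?addr_ge0 ?exprn_ge0 ?ltW.
  - by rewrite natrX nl expRM_natl.
  - by apply: ler_pM; rewrite ?exprn_ge0 ?addr_ge0 ?expr1D_le_expR ?exprn_ge0 ?ltW.
rewrite ltr_expR.
(* Here [1 < k] is used: [k ^ 2 <= 2 * k * (k - 1)]. *)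
have Ck : (k%:R ^+ 2 : R) <= 4 * 'C(k, 2)%:R.
  have : (k ^ 2 <= 4 * 'C(k, 2))%N.
    by have := bin_ffact k 2; rewrite ffactnSr ffactn1 (_ : 2`! = 2)%N //; nia.
  by rewrite -(ler_nat R) natrX (natrM R 4).
rewrite (natrM R (k ^ 2) n) (natrM R (k ^ 2) (n ^ 3)) !natrX.
have nx2 : n%:R * x ^+ 2 <= 64^-1.
  have -> : n%:R * x ^+ 2 = (64 * s ^+ 2)^-1.
    by rewrite -sn xE; field; rewrite gt_eqF.
  by rewrite lef_pV2 ?posrE ?mulr_gt0 ?exprn_gt0 // ler_peMr ?exprn_ege1.
have nx4 : n%:R ^+ 3 * x ^+ 4 = 4096^-1.
  by rewrite -sn xE; field; rewrite gt_eqF.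
have kx : 16 * l <= k%:R * x.
  have -> : 16 * l = 128 * s ^+ 3 * l * x.
    by rewrite xE; field; rewrite gt_eqF.
  by rewrite ler_pM2r.
have k0 : 0 < k%:R :> R by rewrite ltr0n ltnW.
have kl : 16 * (k%:R * l) <= k%:R ^+ 2 * x.
  by have := ler_wpM2l (ltW k0) kx; lra.
have A0 : 0 < k%:R ^+ 2 * x by rewrite mulr_gt0 ?exprn_gt0.
have c3 : k%:R ^+ 2 * n%:R * x ^+ 3 <= k%:R ^+ 2 * x * 64^-1.
  have -> : k%:R ^+ 2 * n%:R * x ^+ 3 = k%:R ^+ 2 * x * (n%:R * x ^+ 2) by ring.
  by rewrite ler_pM2l.
have c5 : k%:R ^+ 2 * n%:R ^+ 3 * x ^+ 5 = k%:R ^+ 2 * x * 4096^-1.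
  by rewrite -nx4; ring.
have cC : k%:R ^+ 2 * x <= 4 * 'C(k, 2)%:R * x by rewrite ler_pM2r.
by rewrite c5; move: kl A0 c3 cC; clear; lra.
Qed.

Lemma ln2_bounds : 1 / 2 <= ln (2 : R) <= 1.
Proof.
apply/andP; split; last first.
  by have := @le_ln1Dx R 1; rewrite -[1 + 1]/2; apply; lra.
rewrite -[leLHS]expRK ler_ln ?posrE ?expR_gt0 //.
have := expR_ge1Dx (- (1 / 2 : R)); have := expRxMexpNx_1 (1 / 2 : R).
have := expR_gt0 (1 / 2 : R); nra.
Qed.

Lemma h2_le_power (n : nat) : (1 < n)%N ->
  (h2 n forbidden)%:R <= 262 * (n%:R `^ (3 / 4) * log2 n%:R) :> R.
Proof.
move=> n1; have n0 : 0 < n%:R :> R by rewrite ltr0n; lia.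
set s : R := n%:R `^ (1 / 4).
have s0 : 0 < s by apply: powR_gt0.
have s4 : s ^+ 4 = n%:R.
  by rewrite -powR_mulrn ?ltW // -powRrM (_ : 1 / 4 * 4 = 1) ?powRr1 ?ltW //; lra.
have s3 : n%:R `^ (3 / 4) = s ^+ 3.
  by rewrite -powR_mulrn ?ltW // -powRrM; congr (_ `^ _); lra.
have s1 : 1 <= s ^+ 3.
  rewrite -s3 -[leLHS](powRr0 n%:R); by apply: ler_powR; [rewrite ler1n; lia | lra].
have /andP[ln2a ln2b] := ln2_bounds.
have ln2n : ln 2 <= ln n%:R :> R by rewrite ler_ln ?posrE // ler_nat.
have le_log2 : ln n%:R <= log2 n%:R :> R.
  by rewrite /log2 ler_pdivlMr; nra.
set t : R := 128 * s ^+ 3 * ln n%:R.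
have t1 : 64 <= t by rewrite /t; nra.
pose k := (Num.truncn t).+1.
have tk : t <= k%:R by rewrite ltW // real_truncnS_gt // num_real.
have kt : k%:R <= t + 1.
  by rewrite /k -natr1 lerD2r truncn_le; lra.
have k1 : (1 < k)%N by rewrite -(ltr_nat R); lra.
have x0 : 0 <= (8 * s ^+ 3)^-1 by rewrite invr_ge0 mulr_ge0 ?exprn_ge0 ?ltW.
have [e [e_sym e3 e5 e_alpha]] := sparse_graph x0
  (deletion_condition n1 k1 s0 s4 tk erefl).
have := h2_upper e_sym e3 e5 e_alpha; rewrite -(ler_nat R) => /le_trans; apply.
rewrite -addn1 natrD -muln2 natrM s3.
have : s ^+ 3 * ln n%:R <= s ^+ 3 * log2 n%:R by rewrite ler_wpM2l //; lra.
(* [2 * k + 1 <= 2 * t + 3]; the term [2 * t] gives the factor 256, and [64 <= t] absorbs 3 into the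
   remaining 6. *)
rewrite /t in kt t1; lra.
Qed.

Lemma power_le_h2 (n : nat) : (16 <= n)%N ->
  n%:R `^ (2 / 3) * log2 n%:R `^ (1 / 3) <= 64 * (h2 n forbidden)%:R :> R.
Proof.
move=> n16; have n0 : 0 < n%:R :> R by rewrite ltr0n; lia.
have /andP[ln2a ln2b] := ln2_bounds.
set ell := trunc_log 2 n; pose L := (ell %/ 4)%N.
have ell4 : (4 <= ell)%N by apply: trunc_log_max.
have L1 : (ell < 4 * L + 4)%N by rewrite /L; lia.
have L0 : (0 < L)%N by rewrite /L; lia.
have nL : (2 ^ (4 * L) <= n)%N.
  apply: (@leq_trans (2 ^ ell)); last by apply: trunc_logP => //; lia.
  by rewrite leq_exp2l // mulnC leq_trunc_div.
have logn0 : 0 <= log2 n%:R :> R.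
  by rewrite /log2 divr_ge0 //; [rewrite ln_ge0 // ler1n; lia | lra].
(* [log2 n <= ell + 1 <= 4 * L + 4 <= 8 * L], the last step because [L >= 1] once [n >= 16]. *)
have logn : log2 n%:R <= 8 * L%:R :> R.
  rewrite /log2 ler_pdivrMr; last lra.
  apply: (@le_trans _ _ (ln ((2 : R) ^+ ell.+1))).
    rewrite ler_ln ?posrE ?exprn_gt0 // -natrX ler_nat ltnW //.
    exact: trunc_log_ltn.
  rewrite lnXn // -(mulr_natl _ ell.+1) ler_wpM2r //; first lra.
  by rewrite -(natrM R 8) ler_nat; move: L1 L0; clear; lia.
have := h2_lower nL; rewrite -(ler_nat R) (natrM R (n ^ 2)) (natrM R (2 ^ 15)) !natrX => low.
set h : R := (h2 n forbidden)%:R in low *.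
have h0 : 0 <= h by apply: ler0n.
have g0 : 0 <= n%:R `^ (2 / 3) * log2 n%:R `^ (1 / 3) :> R.
  by rewrite mulr_ge0 ?powR_ge0.
(* Compare cubes: [n ^ 2 * log2 n <= 8 * 2 ^ 15 * h ^ 3 = (64 * h) ^ 3]. *)
rewrite -(@ler_pXn2r _ 3) ?nnegrE //; last by rewrite mulr_ge0.
have g1 : (n%:R `^ (2 / 3)) ^+ 3 = n%:R ^+ 2 :> R.
  rewrite -powR_mulrn ?powR_ge0 // -powRrM (_ : 2 / 3 * 3 = 2); last lra.
  by rewrite powR_mulrn // ltW.
have g2 : (log2 n%:R `^ (1 / 3)) ^+ 3 = log2 n%:R :> R.
  rewrite -powR_mulrn ?powR_ge0 // -powRrM (_ : 1 / 3 * 3 = 1); last lra.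
  by rewrite powRr1.
rewrite exprMn g1 g2 exprMn.
have : n%:R ^+ 2 * log2 n%:R <= n%:R ^+ 2 * (8 * L%:R) :> R.
  by rewrite ler_wpM2l // exprn_ge0 // ltW.
lra.
Qed.

End Estimates.

Unset Implicit Arguments.
Local Open Scope classical_set_scope.

Theorem lemma3p18 (R : realType) :
  let H := [fset [mset Red; Red; Red]%mset; [mset Red; Red; Blue]%mset;
                 [mset Yellow; Yellow; Red]%mset]%fset in
  (fun n : nat => (h2 n H)%:R : R^o) =Omega_\oo
    (fun n : nat => n%:R `^ (2 / 3) * log2 n%:R `^ (1 / 3) : R^o)
  /\
  (fun n : nat => (h2 n H)%:R : R^o) =O_\oo
    (fun n : nat => n%:R `^ (3 / 4) * log2 n%:R : R^o).
Proof.
split.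
- rewrite eqOmegaE eqOmegaO; apply/eqO_exP; exists 64 => //.
  near=> n; rewrite !ger0_norm ?ler0n //; last first.
    by rewrite mulr_ge0 ?powR_ge0.
  by apply: power_le_h2; near: n; apply: nbhs_infty_ge.
- apply/eqO_exP; exists 262 => //.
  near=> n; have n2 : (1 < n)%N by near: n; apply: nbhs_infty_ge.
  have := h2_le_power R n2; rewrite ger0_norm ?ler0n // => /le_trans; apply.
  by rewrite ler_wpM2l // ler_norm.
Unshelve. all: by end_near.
Qed.
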